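(* If $\varphi:\mathcal A\to M_n(\mathbb C)$ is a linear isometry, then for all $k=1,2,\dots,n-1$, $$\ker\varphi(S)\subseteq\ker\varphi(S^k)\quad\text{and}\quad \operatorname{ran}\varphi(S)\supseteq\operatorname{ran}\varphi(S^k).$$
   Context: $S$ denotes the $n\times n$ nilpotent Jordan block with ones on the superdiagonal and zeros elsewhere. $\mathcal A=\{f(S): f\text{ a complex polynomial}\}$ is the algebra of $n\times n$ upper-triangular Toeplitz matrices. $M_n(\mathbb C)$ carries the operator norm induced by the Euclidean norm on $\mathbb C^n$; a linear isometry is a linear map with $\|\varphi(A)\|=\|A\|$ for all $A$. $\ker$ and $\operatorname{ran}$ denote kernel and range of a matrix acting on $\mathbb C^n$. *)

(* Defs.v *)
(* The complex field is modelled by an arbitrary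
   numClosedFieldType C (e.g. algC). *)
From HB Require Import structures.
From mathcomp Require Import all_boot all_order all_algebra.
Set Implicit Arguments. Unset Strict Implicit. Unset Printing Implicit Defensive.
Import Order.TTheory GRing.Theory Num.Theory.
Local Open Scope ring_scope.

Definition jordanS (C : numClosedFieldType) (n : nat) : 'M[C]_n :=
  \matrix_(i < n, j < n) (((i : nat).+1 == j)%:R : C).

(* k-th power of a square matrix (via *m, valid for every n). *)
Fixpoint mxpow (C : numClosedFieldType) (n : nat) (A : 'M[C]_n) (k : nat) : 'M[C]_n :=
  match k with
  | 0 => 1%:M
  | k'.+1 => A *m mxpow A k'
  end.

(* Membership in the algebra A = { f(S) : f a polynomial } of upper-triangular
   Toeplitz matrices. Since S^k = 0 for k >= n, f(S) is a combination of
   S^0, ..., S^(n-1); we allow any finite combination. *)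
Definition inToeplitz (C : numClosedFieldType) (n : nat) (A : 'M[C]_n) : Prop :=
  exists (m : nat) (c : 'I_m -> C),
    A = \sum_(k < m) c k *: mxpow (jordanS C n) k.

Definition vnorm2 (C : numClosedFieldType) (n : nat) (x : 'cV[C]_n) : C :=
  \sum_(i < n) `|x i 0| ^+ 2.

(* c >= 0 bounds the operator norm of A: ||A x|| <= c ||x|| for all x.
   The operator norm ||A|| is the least such c, so
   ||A|| = ||B||  iff  A and B have the same set of bounds. *)
Definition opnorm_le (C : numClosedFieldType) (n : nat) (A : 'M[C]_n) (c : C) : Prop :=
  forall x : 'cV[C]_n, vnorm2 (A *m x) <= c ^+ 2 * vnorm2 x.

(* phi (a function on all matrices, only its values on the algebra matter)
   is a linear map on the Toeplitz algebra. *)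
Definition linear_on_A (C : numClosedFieldType) (n : nat) (phi : 'M[C]_n -> 'M[C]_n) : Prop :=
  forall (a : C) (A B : 'M[C]_n), inToeplitz A -> inToeplitz B ->
    phi (a *: A + B) = a *: phi A + phi B.

(* phi is isometric for the operator norm on the Toeplitz algebra:
   ||phi A|| = ||A||, expressed as equality of the sets of norm bounds. *)
Definition isometry_on_A (C : numClosedFieldType) (n : nat) (phi : 'M[C]_n -> 'M[C]_n) : Prop :=
  forall A : 'M[C]_n, inToeplitz A ->
    forall c : C, 0 <= c -> (opnorm_le (phi A) c <-> opnorm_le A c).

(* Main.v *)
(* Put X_k = phi(1)^* phi(S^k).  For |w| = 1 let h_w = 1 + 2 sum_(k >= 1) (w^* z)^k,
   so that Re h_w(S) is the rank one matrix v_w v_w^* with v_w = (w^i)_i.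
   Expanding || 1 - t B || to first order in t shows that, on the space E
   where phi(1) attains its norm, Re (phi(1)^* phi(B)) is positive
   if Re B is, and not positive definite if Re B is not.  Let w_i run through the n
   solutions of w^n = b^n, |b| = 1, and let P_i = Re (phi(1)^* phi(h_(w_i))),
   so that sum_i P_i = n X_0.  As the sum of the v_w v_w^* over n - 1 of the w_i
   is singular, some u_i <> 0 in E is killed by all P_j with j <> i.  The u_i are
   then orthogonal, so E is the whole space, X_0 = 1 and P_i is n times the
   orthogonal projection on u_i.  Hence
   X_k + b^n X_(n-k)^* = (1/n) sum_i w_i^k P_i = (X_1 + b^n X_(n-1)^* )^k,
   and comparing constant terms in b gives X_k = X_1^k. *)
Require Import Defs.
From HB Require Import structures.
From mathcomp Require Import all_boot all_order all_algebra all_solvable all_field.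
From mathcomp Require Import ring zify.
Import Order.TTheory GRing.Theory Num.Theory.
Local Open Scope ring_scope.
Local Open Scope sesquilinear_scope.

(** * Hermitian inner product, operator bounds and the spectral theorem *)

Definition dot (C : numClosedFieldType) (n : nat) (u v : 'cV[C]_n) : C :=
  \sum_i (u i 0)^* * v i 0.
Arguments dot {C n}.

Section InnerProduct.
Variables (C : numClosedFieldType) (n : nat).
Implicit Types (u v w : 'cV[C]_n) (A M : 'M[C]_n) (a : C).

Lemma vnorm2E u : vnorm2 u = dot u u.
Proof. by apply: eq_bigr => i _; rewrite normCK mulrC. Qed.

Lemma dotDl u v w : dot (u + v) w = dot u w + dot v w.
Proof.
by rewrite -big_split; apply: eq_bigr => i _; rewrite mxE rmorphD mulrDl.
Qed.

Lemma dotDr u v w : dot w (u + v) = dot w u + dot w v.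
Proof. by rewrite -big_split; apply: eq_bigr => i _; rewrite mxE mulrDr. Qed.

Lemma dotZl a u v : dot (a *: u) v = a^* * dot u v.
Proof.
by rewrite big_distrr; apply: eq_bigr => i _; rewrite mxE rmorphM /= mulrA.
Qed.

Lemma dotZr a u v : dot u (a *: v) = a * dot u v.
Proof.
by rewrite big_distrr; apply: eq_bigr => i _; rewrite mxE mulrCA.
Qed.

Lemma dotNl u v : dot (- u) v = - dot u v.
Proof. by rewrite -scaleN1r dotZl rmorphN rmorph1 mulN1r. Qed.

Lemma dotNr u v : dot u (- v) = - dot u v.
Proof. by rewrite -scaleN1r dotZr mulN1r. Qed.

Lemma dot0r u : dot u 0 = 0.
Proof. by rewrite -(scale0r u) dotZr mul0r. Qed.

Lemma dotC u v : (dot u v)^* = dot v u.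
Proof.
rewrite rmorph_sum; apply: eq_bigr => i _.
by rewrite rmorphM /= conjCK mulrC.
Qed.

Lemma dot0l u : dot 0 u = 0.
Proof. by rewrite -dotC dot0r rmorph0. Qed.

Lemma dot_sumr (I : Type) (r : seq I) (P : pred I) (F : I -> 'cV[C]_n) u :
  dot u (\sum_(i <- r | P i) F i) = \sum_(i <- r | P i) dot u (F i).
Proof. by apply: (big_morph (dot u) _ (dot0r u)) => v w; rewrite dotDr. Qed.

Lemma dot_ge0 u : 0 <= dot u u.
Proof. by rewrite -vnorm2E sumr_ge0 // => i _; rewrite exprn_ge0. Qed.

Lemma dot_eq0 u : (dot u u == 0) = (u == 0).
Proof.
apply/eqP/eqP => [|->]; last exact: dot0r.
rewrite -vnorm2E => /eqP.
rewrite psumr_eq0 => [/allP u0|i _]; last by rewrite exprn_ge0.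
apply/colP => i; apply/eqP; rewrite mxE.
by have := u0 i (mem_index_enum i); rewrite expf_eq0 normr_eq0.
Qed.

Lemma dot_gt0 u : (0 < dot u u) = (u != 0).
Proof. by rewrite lt_def dot_eq0 dot_ge0 andbT. Qed.

Lemma dot_mulmxr A u v : dot u (A *m v) = dot (A^t* *m u) v.
Proof.
rewrite /dot; under eq_bigr => i _ do rewrite mxE big_distrr.
rewrite exchange_big; apply: eq_bigr => j _ /=.
rewrite mxE rmorph_sum big_distrl; apply: eq_bigr => i _ /=.
by rewrite !mxE rmorphM /= conjCK mulrA (mulrC (A i j)).
Qed.

Lemma dot_mulmxl A u v : dot (A *m u) v = dot u (A^t* *m v).
Proof. by rewrite dot_mulmxr trmxCK. Qed.

Lemma trmxC_mul A M : (A *m M)^t* = M^t* *m A^t*.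
Proof. by rewrite trmx_mul map_mxM. Qed.

(** Each coordinate of [u] is at most its norm, so entry i of [A *m u] is at most the absolute row
    sum [s i] times that norm. The added 1 keeps [K] positive when [A] is 0. *)
Lemma opnorm_bounded A :
  exists2 K : C, 0 < K & forall u, dot (A *m u) (A *m u) <= K * dot u u.
Proof.
pose s i := \sum_j `|A i j|.
have s_ge0 i : 0 <= s i by apply: sumr_ge0.
have S_ge0 : 0 <= \sum_i s i ^+ 2 by apply: sumr_ge0 => i _; rewrite exprn_ge0.
exists (1 + \sum_i s i ^+ 2); first by rewrite ltr_wpDr.
move=> u; rewrite mulrDl mul1r -!vnorm2E.
apply: ler_wpDl; first by rewrite vnorm2E dot_ge0.
rewrite big_distrl; apply: ler_sum => i _ /=.
have N_ge0 : 0 <= vnorm2 u by rewrite vnorm2E dot_ge0.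
rewrite -(sqrtCK (vnorm2 u)) -exprMn lerXn2r ?nnegrE ?mulr_ge0 ?sqrtC_ge0 //.
rewrite mxE (le_trans (ler_norm_sum _ _ _)) // big_distrl ler_sum // => j _.
rewrite normrM ler_wpM2l // -[leLHS]sqrCK // ler_sqrtC ?nnegrE ?exprn_ge0 //.
by rewrite /vnorm2 (bigD1 j) //= lerDl sumr_ge0 // => k _; rewrite exprn_ge0.
Qed.

Lemma hermitian_spectral A : A^t* = A ->
  exists P (d : 'rV[C]_n), [/\ P^t* *m P = 1%:M, P *m P^t* = 1%:M,
    forall i, d 0 i \is Num.real & A = P^t* *m diag_mx d *m P].
Proof.
move=> hA; have hermA : A \is hermsymmx by apply/is_hermitianmxP; rewrite scale1r hA.
have uP := spectral_unitarymx A.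
exists (spectralmx A), (spectral_diag A); split.
- by rewrite -invmx_unitary // mulVmx // spectral_unit.
- exact/unitarymxP.
- move=> i; have /mxOverP := hermitian_spectral_diag_real hermA; exact.
- rewrite -invmx_unitary //; apply/orthomx_spectralP.
  exact: hermitian_normalmx.
Qed.

Lemma dot_diag (d : 'rV[C]_n) u v :
  dot u (diag_mx d *m v) = \sum_i d 0 i * ((u i 0)^* * v i 0).
Proof.
by apply: eq_bigr => i _; rewrite mul_diag_mx mxE mulrCA.
Qed.

End InnerProduct.

(** The order of [C] is only partial, so a closed formula replaces the minimum: the inverse of 1
    plus all the inverses lies below each [d i]. *)
Lemma pos_lower_bound (C : numClosedFieldType) (I : finType) (P : pred I)
    (d : I -> C) : (forall i, P i -> 0 < d i) ->
  exists2 eta : C, 0 < eta & forall i, P i -> eta <= d i.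
Proof.
move=> d_gt0.
have s_ge0 (Q : pred I) : subpred Q P -> 0 <= \sum_(i | Q i) (d i)^-1.
  by move=> QP; apply: sumr_ge0 => i /QP Pi; rewrite invr_ge0 ltW ?d_gt0.
exists (1 + \sum_(i | P i) (d i)^-1)^-1; first by rewrite invr_gt0 ltr_wpDr ?s_ge0.
move=> i Pi; have s'_ge0 : 0 <= \sum_(j | P j && (j != i)) (d j)^-1.
  by apply: s_ge0 => j /andP[].
rewrite (bigD1 i) //= -[leRHS]invrK lef_pV2 ?posrE ?invr_gt0 ?d_gt0 //.
  by rewrite addrCA lerDl addr_ge0.
by rewrite addrCA ltr_wpDr ?invr_gt0 ?d_gt0 ?addr_ge0.
Qed.

(** * Finsler's lemma on positivity over a kernel *)

Section Finsler.
Variables (C : numClosedFieldType) (n : nat).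
Implicit Types (u v e : 'cV[C]_n) (A M P Q : 'M[C]_n).

(** [Q] is the spectral projection onto the kernel of [A], and [eta] bounds the nonzero eigenvalues
    from below. *)
Lemma psd_kernel_projection A : A^t* = A -> (forall u, 0 <= dot u (A *m u)) ->
  exists Q (eta : C), [/\ Q^t* = Q, Q *m Q = Q, A *m Q = 0, 0 < eta &
    forall u, eta * dot (u - Q *m u) (u - Q *m u) <= dot u (A *m u)].
Proof.
move=> hA psdA; have [P [d [P'P PP' d_real defA]]] := hermitian_spectral _ _ _ hA.
have dotA u : dot u (A *m u) = \sum_i d 0 i * `|(P *m u) i 0| ^+ 2.
  rewrite defA -!mulmxA dot_mulmxr trmxCK dot_diag.
  by apply: eq_bigr => i _; rewrite normCK [(_ i 0) * _]mulrC.
have d_ge0 i : 0 <= d 0 i.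
  have := psdA (P^t* *m delta_mx i 0).
  rewrite dotA mulmxA PP' mul1mx (bigD1 i) //= big1 => [|j ji].
    by rewrite !mxE !eqxx normr1 expr1n mulr1 addr0.
  by rewrite !mxE (negPf ji) normr0 expr0n mulr0.
have [|eta eta_gt0 le_eta] := @pos_lower_bound C _ (fun i => d 0 i != 0) (d 0).
  by move=> i di; rewrite lt_def di d_ge0.
pose z : 'rV[C]_n := \row_i (d 0 i == 0)%:R.
have adj_z : (diag_mx z)^t* = diag_mx z.
  rewrite tr_diag_mx map_diag_mx; congr diag_mx.
  by apply/rowP => i; rewrite !mxE rmorph_nat.
exists (P^t* *m diag_mx z *m P), eta; split => //.
- by rewrite !trmxC_mul trmxCK adj_z mulmxA.
- rewrite !mulmxA -[_ *m P *m _]mulmxA PP' mulmx1 -[X in X *m P]mulmxA.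
  rewrite mulmx_diag; congr (_ *m diag_mx _ *m _); apply/rowP => i.
  by rewrite !mxE -natrM mulnb andbb.
- rewrite defA !mulmxA -[_ *m P *m _]mulmxA PP' mulmx1 -[X in X *m P]mulmxA.
  rewrite mulmx_diag; suff -> : (\row_j (d 0 j * z 0 j)) = 0.
    by rewrite raddf0 mulmx0 mul0mx.
  apply/rowP => i; rewrite !mxE; case: eqP => [->|_]; first by rewrite mul0r.
  by rewrite mulr0.
- move=> u; set b := u - _.
  have Pb : P *m b = P *m u - diag_mx z *m (P *m u).
    by rewrite mulmxBr !mulmxA PP' mul1mx.
  have -> : dot b b = dot (P *m b) (P *m b).
    by rewrite dot_mulmxr mulmxA P'P mul1mx.
  rewrite dotA -vnorm2E big_distrr; apply: ler_sum => i _ /=.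
  rewrite Pb; move: (P *m u) => y; rewrite mul_diag_mx !mxE.
  case: eqP => [->|/eqP di]; first by rewrite mul1r subrr normr0 expr0n mulr0 mul0r.
  by rewrite mul0r subr0 ler_wpM2r ?exprn_ge0 ?le_eta.
Qed.

Lemma hermitian_pos_or_eigen M : M^t* = M ->
  (exists e d, [/\ e != 0, d <= 0 & M *m e = d *: e]) \/
  (exists2 mu : C, 0 < mu & forall u, mu * dot u u <= dot u (M *m u)).
Proof.
move=> hM; have [P [d [P'P PP' d_real defM]]] := hermitian_spectral _ _ _ hM.
case: (boolP [forall i, 0 < d 0 i]) => [/forallP d_gt0|].
  right; have [|mu mu_gt0 le_mu] := @pos_lower_bound C _ xpredT (d 0).
    by move=> i _; apply: d_gt0.
  exists mu => // u.
  have -> : dot u u = dot (P *m u) (P *m u).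
    by rewrite dot_mulmxr mulmxA P'P mul1mx.
  rewrite defM -!mulmxA [leRHS]dot_mulmxr trmxCK dot_diag -vnorm2E big_distrr.
  apply: ler_sum => i _ /=.
  by rewrite -normCKC ler_wpM2r ?exprn_ge0 ?le_mu.
rewrite negb_forall => /existsP[i di]; left.
exists (P^t* *m delta_mx i 0), (d 0 i); split.
- apply/eqP => /(congr1 (mulmx P)) /matrixP/(_ i 0) /eqP.
  by rewrite mulmx0 mulmxA PP' mul1mx !mxE !eqxx oner_eq0.
- by rewrite real_leNgt ?real0.
- rewrite defM !mulmxA -[_ *m P *m _]mulmxA PP' mulmx1 -mulmxA scalemxAr.
  congr (_ *m _); apply/colP => j; rewrite mul_diag_mx !mxE eqxx andbT.
  by case: eqP => [->|_]; rewrite ?mulr0.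
Qed.

(** The spectrum of the compression of [M] to the kernel of [A], completed by the identity on the
    orthogonal complement, decides between the cases. In the second one a large [t] absorbs the
    cross terms between kernel and complement. *)
Lemma finsler A M : A^t* = A -> M^t* = M -> (forall u, 0 <= dot u (A *m u)) ->
  (exists u, [/\ u != 0, A *m u = 0 & dot u (M *m u) <= 0]) \/
  (exists t mu : C, [/\ 0 < t, 0 < mu &
     forall u, mu * dot u u <= t * dot u (A *m u) + dot u (M *m u)]).
Proof.
move=> hA hM psdA.
have [Q [eta [hQ QQ AQ eta_gt0 le_eta]]] := psd_kernel_projection A hA psdA.
have dotQ u v : dot u (Q *m v) = dot (Q *m u) v by rewrite dot_mulmxr hQ.
have [||[mu mu_gt0 le_mu]] := hermitian_pos_or_eigen (Q *m M *m Q + (1%:M - Q)).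
- rewrite linearD linearB /= map_mxD map_mxB /= !trmxC_mul hQ hM mulmxA.
  by rewrite trmx1 map_mx1.
- move=> [e [d [e0 d_le0 De]]]; left; exists (Q *m e); split.
  (* If [Q *m e] vanished, the completed matrix would fix [e], forcing d = 1 against d <= 0. *)
  + apply/eqP => Qe0; have := De.
    rewrite mulmxDl mulmxBl -!mulmxA Qe0 !mulmx0 add0r mul1mx subr0.
    move=> /eqP; rewrite -subr_eq0 -[X in X - _]scale1r -scalerBl scaler_eq0.
    rewrite (negPf e0) orbF subr_eq0 => /eqP d1.
    by move: d_le0; rewrite -d1 ler10.
  + by rewrite mulmxA AQ mul0mx.
  + have -> : dot (Q *m e) (M *m (Q *m e)) =
      d * dot e e - dot (e - Q *m e) (e - Q *m e).
      have -> : dot (Q *m e) (M *m (Q *m e)) = dot e (Q *m M *m Q *m e).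
        by rewrite -!mulmxA [RHS]dotQ.
      have -> : dot (e - Q *m e) (e - Q *m e) = dot e ((1%:M - Q) *m e).
        rewrite mulmxBl mul1mx !(dotDl, dotDr, dotNl, dotNr) -!dotQ mulmxA QQ.
        ring.
      by rewrite -dotZr -De mulmxDl dotDr addrK.
    by rewrite subr_le0 (le_trans _ (dot_ge0 _ _ _)) // mulr_le0_ge0 ?dot_ge0.
right.
have [K K_gt0 le_K] := opnorm_bounded C n M.
(* Half of [mu] is given up to the cross terms. [L] collects the multiples of the squared norm of
   [b] that make the decomposition below an exact identity. *)
pose nu := mu / 2%:R.
have nu_gt0 : 0 < nu by rewrite divr_gt0.
pose L := 2%:R^-1 + (nu^-1 + 2%:R^-1) * K + nu.
exists (L / eta), nu; split=> // [|u].
  by rewrite divr_gt0 // !addr_gt0 ?mulr_gt0 ?addr_gt0 ?invr_gt0.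
rewrite -subr_ge0.
set a := Q *m u; set b := u - a.
have Qa : Q *m a = a by rewrite mulmxA QQ.
have Qb : Q *m b = 0 by rewrite mulmxBr Qa subrr.
have ab : dot a b = 0 by rewrite -Qa -dotQ Qb dot0r.
have ba : dot b a = 0 by rewrite -dotC ab rmorph0.
have Mab : dot (M *m b) a = dot b (M *m a) by rewrite dot_mulmxl hM.
have aMb : dot (M *m b) b = dot b (M *m b) by rewrite dot_mulmxl hM.
have h1 : 0 <= dot a (M *m a) - mu * dot a a.
  rewrite subr_ge0 (le_trans (le_mu a)) // mulmxDl mulmxBl mul1mx Qa subrr addr0.
  by rewrite -!mulmxA Qa dotQ Qa.
(* The cross terms of [dot (a + b) (M *m (a + b))] are absorbed by [h2] and [h3]. *)
have h2 : 0 <= dot (nu *: a + M *m b) (nu *: a + M *m b) by exact: dot_ge0.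
have h3 : 0 <= dot (b + M *m b) (b + M *m b) by exact: dot_ge0.
have h4 : 0 <= K * dot b b - dot (M *m b) (M *m b) by rewrite subr_ge0.
have h5 : 0 <= dot u (A *m u) - eta * dot b b by rewrite subr_ge0 le_eta.
set q := dot u (A *m u) in h5 *.
have ub : u = a + b by rewrite addrC subrK.
clearbody q b; rewrite ub.
have conj_nu : nu^* = nu by rewrite geC0_conj // ltW.
have -> : L / eta * q + dot (a + b) (M *m (a + b)) - nu * dot (a + b) (a + b) =
  (dot a (M *m a) - mu * dot a a)
  + nu^-1 * dot (nu *: a + M *m b) (nu *: a + M *m b)
  + 2%:R^-1 * dot (b + M *m b) (b + M *m b)
  + (nu^-1 + 2%:R^-1) * (K * dot b b - dot (M *m b) (M *m b))
  + L / eta * (q - eta * dot b b).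
  rewrite mulmxDr !(dotDl, dotDr, dotZl, dotZr) Mab aMb ab ba conj_nu.
  have -> : mu = 2%:R * nu by rewrite mulrC divfK // pnatr_eq0.
  rewrite /L; field.
  by rewrite (gt_eqF eta_gt0) (gt_eqF nu_gt0).
have L_gt0 : 0 < L / eta.
  by rewrite divr_gt0 // !addr_gt0 ?mulr_gt0 ?addr_gt0 ?invr_gt0.
have nuV_ge0 : 0 <= nu^-1 by rewrite invr_ge0 ltW.
apply: addr_ge0; last exact: mulr_ge0 (ltW L_gt0) h5.
apply: addr_ge0; last by apply: (mulr_ge0 _ h4); rewrite addr_ge0 // invr_ge0.
apply: addr_ge0; last by apply: (mulr_ge0 _ h3); rewrite invr_ge0.
exact: addr_ge0 h1 (mulr_ge0 nuV_ge0 h2).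
Qed.

End Finsler.

(** * First-order expansion of the norm, with [T0] and [TB] standing for phi(1) and phi(B) *)

Section Perturbation.
Variables (C : numClosedFieldType) (n : nat).
Implicit Types (u v : 'cV[C]_n) (A B T : 'M[C]_n).

Lemma dot_hermitian_part A B u :
  dot u ((A^t* *m B + B^t* *m A) *m u) =
  dot (A *m u) (B *m u) + dot (B *m u) (A *m u).
Proof. by rewrite mulmxDl dotDr -!mulmxA -!dot_mulmxl. Qed.

Lemma dot_perturb A B u (t : C) : t^* = t ->
  dot ((A - t *: B) *m u) ((A - t *: B) *m u) =
  dot (A *m u) (A *m u) - t * dot u ((A^t* *m B + B^t* *m A) *m u)
  + t ^+ 2 * dot (B *m u) (B *m u).
Proof.
move=> tR; rewrite dot_hermitian_part mulmxBl -scalemxAl.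
rewrite !(dotDl, dotDr, dotNl, dotNr, dotZl, dotZr) tR; ring.
Qed.

Lemma trmxC_hermitian_part A B :
  (A^t* *m B + B^t* *m A)^t* = A^t* *m B + B^t* *m A.
Proof. by rewrite linearD map_mxD /= !trmxC_mul !trmxCK addrC. Qed.

Lemma real_hermitian_part A B u :
  dot u ((A^t* *m B + B^t* *m A) *m u) \is Num.real.
Proof.
by apply/CrealP; rewrite dotC dot_mulmxl trmxC_hermitian_part.
Qed.

Variables (T0 TB B : 'M[C]_n).
Hypothesis iso : forall t c : C, 0 <= c ->
  opnorm_le (T0 - t *: TB) c <-> opnorm_le (1%:M - t *: B) c.

Lemma contraction_base u : dot (T0 *m u) (T0 *m u) <= dot u u.
Proof.
have /(iso 0 _ ler01) : opnorm_le (1%:M - 0 *: B) 1.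
  by move=> x; rewrite scale0r subr0 mul1mx expr1n mul1r.
by move=> /(_ u); rewrite scale0r subr0 expr1n mul1r !vnorm2E.
Qed.

Lemma first_order_ge0 u :
  (forall v, 0 <= dot v ((1%:M^t* *m B + B^t* *m 1%:M) *m v)) ->
  T0^t* *m T0 *m u = u ->
  0 <= dot u ((T0^t* *m TB + TB^t* *m T0) *m u).
Proof.
move=> psdB Eu; set q := dot u _.
have q_real : q \is Num.real := real_hermitian_part _ _ _.
have [K K_gt0 le_K] := opnorm_bounded C n B.
have q_ge (t : C) : 0 < t -> - (t * (K * dot u u)) <= q.
  move=> t_gt0; have tR : t^* = t by rewrite geC0_conj // ltW.
  have c2_ge0 : 0 <= 1 + t ^+ 2 * K.
    by rewrite addr_ge0 // mulr_ge0 ?exprn_ge0 // ltW.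
  have c_ge0 : 0 <= sqrtC (1 + t ^+ 2 * K) by rewrite sqrtC_ge0.
  have /(iso t _ c_ge0) /(_ u) : opnorm_le (1%:M - t *: B) (sqrtC (1 + t ^+ 2 * K)).
    move=> v; rewrite sqrtCK !vnorm2E dot_perturb // mul1mx mulrDl mul1r.
    rewrite -mulrA lerD ?ler_wpM2l ?exprn_ge0 ?(ltW t_gt0) //.
    by rewrite lerBlDr lerDl mulr_ge0 // ltW.
  rewrite sqrtCK !vnorm2E dot_perturb // -/q.
  have -> : dot (T0 *m u) (T0 *m u) = dot u u by rewrite dot_mulmxl mulmxA Eu.
  move=> le_t; rewrite -(ler_pM2l t_gt0) -subr_ge0.
  have -> : t * q - t * - (t * (K * dot u u)) =
    ((1 + t ^+ 2 * K) * dot u u - (dot u u - t * q + t ^+ 2 * dot (TB *m u) (TB *m u)))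
    + t ^+ 2 * dot (TB *m u) (TB *m u) by ring.
  apply: addr_ge0; first by rewrite subr_ge0.
  by rewrite mulr_ge0 ?dot_ge0 // exprn_ge0 // ltW.
have [//|q_lt0] := real_leP (real0 C) q_real.
pose m := K * dot u u; have m_ge0 : 0 <= m by rewrite mulr_ge0 ?dot_ge0 // ltW.
have m1_gt0 : 0 < 1 + m by rewrite ltr_wpDr.
(* At this t the bound reads q >= q m / (1 + m), that is q / (1 + m) >= 0, which a negative q
   violates. *)
have /q_ge : 0 < - q / (1 + m) by rewrite divr_gt0 // oppr_gt0.
rewrite -/m -subr_ge0.
have -> : q - - (- q / (1 + m) * m) = q / (1 + m).
  by field; rewrite (gt_eqF m1_gt0).
by rewrite pmulr_lge0 ?invr_gt0 // => /le_lt_trans /(_ q_lt0); rewrite ltxx.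
Qed.

(** The kernel of 1 - [T0^t* *m T0] is the space where [T0] preserves norms. If the form of [TB]
    were positive definite there, Finsler's lemma would give [T0 - e *: TB] norm below 1 for a small
    e > 0, hence also 1 - eB; but 1 - eB does not shrink [v]. *)
Lemma first_order_le0 v : v != 0 ->
  dot v ((1%:M^t* *m B + B^t* *m 1%:M) *m v) <= 0 ->
  exists u, [/\ u != 0, T0^t* *m T0 *m u = u &
    dot u ((T0^t* *m TB + TB^t* *m T0) *m u) <= 0].
Proof.
move=> v0 Bv; have [||u||] := finsler C n (1%:M - T0^t* *m T0)
    (T0^t* *m TB + TB^t* *m T0).
- by rewrite linearB map_mxB /= trmxC_mul trmxCK trmx1 map_mx1.
- exact: trmxC_hermitian_part.
- rewrite mulmxBl mul1mx dotDr dotNr -mulmxA -dot_mulmxl subr_ge0.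
  exact: contraction_base.
- move=> [u [u0 Eu Mu]]; exists u; split=> //.
  by apply/eqP; rewrite eq_sym -subr_eq0 -{1}[u]mul1mx -mulmxBl Eu.
move=> [t [mu [t_gt0 mu_gt0 le_mu]]]; exfalso.
have [K K_gt0 le_K] := opnorm_bounded C n TB.
(* Small enough for [e * t <= 1] and [e * K <= mu / 2]. *)
pose e := (t + 2%:R * K / mu)^-1.
have e_gt0 : 0 < e by rewrite invr_gt0 addr_gt0 ?divr_gt0 ?mulr_gt0.
have eR : e^* = e by rewrite geC0_conj // ltW.
have et_le1 : 0 <= 1 - e * t.
  have -> : 1 - e * t = e * (2%:R * K / mu).
    rewrite /e; field; rewrite (gt_eqF mu_gt0) /= gt_eqF //.
    by rewrite addr_gt0 ?mulr_gt0.
  by rewrite ltW // mulr_gt0 // divr_gt0 // mulr_gt0.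
have eK_le : 0 <= mu / 2%:R - e * K.
  have -> : mu / 2%:R - e * K = e * t * mu / 2%:R.
    rewrite /e; field; rewrite (gt_eqF mu_gt0) /= gt_eqF //.
    by rewrite addr_gt0 ?mulr_gt0.
  by rewrite ltW // divr_gt0 // !mulr_gt0.
(* Of the first-order gain [e * mu], the second-order term costs at most half, because [e * K] is at
   most [mu / 2]. *)
pose c2 := 1 - e * (mu / 2%:R).
have bound u : dot ((T0 - e *: TB) *m u) ((T0 - e *: TB) *m u) <= c2 * dot u u.
  have := le_mu u; have := le_K u; rewrite -subr_ge0 => h1; rewrite -subr_ge0 => h2.
  have := contraction_base u; rewrite -subr_ge0 => h3.
  rewrite dot_perturb //.
  move: h2; rewrite [X in t * dot u X]mulmxBl mul1mx dotDr dotNr -mulmxA -dot_mulmxl.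
  set q := dot u ((_ + _) *m u) => h2.
  rewrite -subr_ge0 /c2; set x := dot (T0 *m u) _ in h2 h3 *.
  have -> : (1 - e * (mu / 2)) * dot u u -
      (x - e * q + e ^+ 2 * dot (TB *m u) (TB *m u)) =
    e * (t * (dot u u - x) + q - mu * dot u u) + (1 - e * t) * (dot u u - x)
    + e ^+ 2 * (K * dot u u - dot (TB *m u) (TB *m u))
    + e * (mu / 2%:R - e * K) * dot u u by field.
  have e_ge0 := ltW e_gt0.
  apply: addr_ge0; last by rewrite !mulr_ge0 ?dot_ge0.
  apply: addr_ge0; last exact: mulr_ge0 (exprn_ge0 _ e_ge0) h1.
  exact: addr_ge0 (mulr_ge0 e_ge0 h2) (mulr_ge0 et_le1 h3).
have v_gt0 : 0 < dot v v by rewrite dot_gt0.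
have c2_ge0 : 0 <= c2.
  by have := le_trans (dot_ge0 _ _ _) (bound v); rewrite pmulr_lge0.
have c_ge0 : 0 <= sqrtC c2 by rewrite sqrtC_ge0.
have /(iso e _ c_ge0) /(_ v) : opnorm_le (T0 - e *: TB) (sqrtC c2).
  by move=> u; rewrite sqrtCK !vnorm2E bound.
rewrite sqrtCK !vnorm2E dot_perturb // mul1mx.
set r := dot v (_ *m v) in Bv *; set p := dot (B *m v) _ => le_v.
have : dot v v <= c2 * dot v v.
  apply: le_trans le_v; rewrite -addrA lerDl -mulrN.
  by rewrite addr_ge0 // mulr_ge0 ?dot_ge0 ?exprn_ge0 ?oppr_ge0 // ltW.
rewrite -{1}[dot v v]mul1r ler_pM2r // /c2 lerDl oppr_ge0 => /le_gtF.
by rewrite mulr_gt0 // divr_gt0.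
Qed.

End Perturbation.

(** * Roots of unity and character sums *)

Section Unity.
Variable C : numClosedFieldType.

(** In characteristic 0 the polynomial X^n - 1 is separable, so it has n distinct roots, and these
    form a cyclic group. *)
Lemma primitive_root_exists n : (0 < n)%N -> exists z : C, n.-primitive_root z.
Proof.
pose p : {poly C} := 'X^n - 1; have [r Dp] := closed_field_poly_normal p.
move=> n_gt0; rewrite (monicP _) ?monicXnsubC // scale1r in Dp.
have rn1 : all n.-unity_root r by apply/allP => z; rewrite -root_prod_XsubC -Dp.
have sz_r : (n <= size r)%N.
  by rewrite -ltnS -(size_prod_XsubC r id) -Dp size_XnsubC.
have [|z _ z_prim] := hasP (has_prim_root n_gt0 rn1 _ sz_r); last by exists z.
by rewrite -separable_prod_XsubC -Dp separable_Xn_sub_1 // pnatr_eq0 -lt0n.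
Qed.

Lemma unity_norm n (z : C) : (0 < n)%N -> z ^+ n = 1 -> `|z| = 1.
Proof.
move=> n_gt0 zn1; apply/eqP; rewrite -(@pexpr_eq1 _ _ n) //.
by rewrite -normrX zn1 normr1.
Qed.

(** The unit circle contains roots of unity of every order, hence more points than [p] could have
    roots. *)
Lemma poly_unimodular_eq0 (p : {poly C}) :
  (forall b : C, `|b| = 1 -> p.[b] = 0) -> p = 0.
Proof.
move=> p0; apply/eqP; apply: contraT => pn0.
have [z z_prim] := primitive_root_exists (size p).+1 isT.
pose rs := [seq z ^+ i | i <- iota 0 (size p).+1].
have : (size rs < size p)%N.
  apply: max_poly_roots pn0 _ _.
    apply/allP => _ /mapP[i _ ->]; apply/eqP/p0.
    by rewrite normrX (unity_norm (size p).+1) ?expr1n ?prim_expr_order.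
  rewrite map_inj_in_uniq ?iota_uniq // => i j.
  rewrite !mem_iota !add0n => /= lt_i lt_j /eqP.
  by rewrite (eq_prim_root_expr z_prim) !modn_small // => /eqP.
by rewrite size_map size_iota ltnNge leqnSn.
Qed.

Lemma sum_unity_root n (x : C) : x ^+ n = 1 -> x != 1 -> \sum_(i < n) x ^+ i = 0.
Proof.
move=> xn1 x1; apply/eqP; have := subrX1 x n; rewrite xn1 subrr => /esym/eqP.
by rewrite mulf_eq0 subr_eq0 (negPf x1).
Qed.

(** The b z^i solve w^n = b^n. The sum is geometric of ratio z^k, which is 1 exactly when n divides
    k. *)
Lemma sum_rotated_roots n (z b : C) k : n.-primitive_root z ->
  \sum_(i < n) (b * z ^+ i) ^+ k = if (n %| k)%N then n%:R * b ^+ k else 0.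
Proof.
move=> z_prim.
have -> : \sum_(i < n) (b * z ^+ i) ^+ k = b ^+ k * \sum_(i < n) (z ^+ k) ^+ i.
  by rewrite big_distrr; apply: eq_bigr => i _; rewrite exprMn exprAC.
rewrite (prim_order_dvd z_prim); case: eqP => [->|/eqP zk1].
  under eq_bigr => i _ do rewrite expr1n.
  by rewrite sumr_const card_ord mulrC.
by rewrite sum_unity_root ?mulr0 // exprAC (prim_expr_order z_prim) expr1n.
Qed.

(** Conjugation inverts z, so the ratio is z^(k - l); with k and l below n it is 1 only for k =
    l. *)
Lemma sum_rotated_roots_conj n (z b : C) k l : n.-primitive_root z ->
  `|b| = 1 -> (k < n)%N -> (l < n)%N ->
  \sum_(i < n) (b * z ^+ i) ^+ k * (b * z ^+ i)^* ^+ l = (k == l)%:R * n%:R.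
Proof.
move=> z_prim b1 lt_k lt_l; have n_gt0 := prim_order_gt0 z_prim.
have zn1 := prim_expr_order z_prim; have z1 := unity_norm _ _ n_gt0 zn1.
have w1 i : `|b * z ^+ i| = 1 by rewrite normrM normrX b1 z1 expr1n mulr1.
have [->|kl] := eqVneq k l.
  under eq_bigr => i _ do rewrite -exprMn -normCK w1 expr1n expr1n.
  by rewrite sumr_const card_ord mul1r.
rewrite mul0r.
transitivity (b ^+ k * b^* ^+ l * \sum_(i < n) (z ^+ k * z^* ^+ l) ^+ i).
  rewrite big_distrr; apply: eq_bigr => i _ /=.
  rewrite rmorphM rmorphXn /= !exprMn -!exprM ![(k * _)%N]mulnC ![(l * _)%N]mulnC.
  ring.
rewrite sum_unity_root ?mulr0 //.
  by rewrite exprMn !(exprAC _ _ n) zn1 -rmorphXn zn1 rmorph1 !expr1n mulr1.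
apply/eqP => zkl; have /eqP : z ^+ k = z ^+ l.
  rewrite -[RHS]mul1r -zkl -mulrA -exprMn [z^* * z]mulrC -normCK z1.
  by rewrite expr1n expr1n mulr1.
by rewrite (eq_prim_root_expr z_prim) !modn_small // (negPf kl).
Qed.

End Unity.

(** * Hermitian matrices summing to a multiple of [X], and their orthogonal eigenbasis *)

Section Resolution.
Variables (C : numClosedFieldType) (n : nat).

(** Equality case of Cauchy-Schwarz. Positivity is asked only along [u + s *: v] and at [v], because
    in the application it is known only on the fixed space of [X]. *)
Lemma psd_isotropic (H : 'M[C]_n) (u v : 'cV[C]_n) : H^t* = H ->
  (forall s, 0 <= dot (u + s *: v) (H *m (u + s *: v))) ->
  0 <= dot v (H *m v) -> dot u (H *m u) = 0 -> dot v (H *m u) = 0.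
Proof.
move=> hH psd q_ge0 Hu; set p := dot v _; set q := dot v _ in q_ge0.
have q1_gt0 : 0 < 1 + q by rewrite ltr_wpDr.
have pC : dot u (H *m v) = p^* by rewrite dotC dot_mulmxl hH.
(* With s = - e p the form takes the value - e^2 (2 + q) |p|^2. Dividing by 1 + q instead of q
   covers q = 0. *)
pose e := (1 + q)^-1; have e_gt0 : 0 < e by rewrite invr_gt0.
have eR : e^* = e by rewrite geC0_conj // ltW.
have := psd (- (e * p)).
rewrite mulmxDr -scalemxAr !(dotDl, dotDr, dotZl, dotZr) Hu -/p -/q pC.
rewrite rmorphN rmorphM /= eR.
rewrite [leRHS](_ : _ = - (e ^+ 2 * (2%:R + q) * (p * p^*))); last first.
  by rewrite /e; field; rewrite gt_eqF.
have c_gt0 : 0 < e ^+ 2 * (2%:R + q) by rewrite mulr_gt0 ?exprn_gt0 // ltr_wpDr.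
rewrite oppr_ge0 pmulr_rle0 // -normCK => p_le0; apply/eqP.
by rewrite -normr_eq0 -sqrf_eq0 eq_le p_le0 exprn_ge0.
Qed.

Variables (P : 'I_n -> 'M[C]_n) (X : 'M[C]_n) (c : C) (u : 'I_n -> 'cV[C]_n).
Hypothesis hP : forall i, (P i)^t* = P i.
Hypothesis c_neq0 : c != 0.
Hypothesis sumP : \sum_i P i = c *: X.
Hypothesis psdP : forall i v, X *m v = v -> 0 <= dot v (P i *m v).
Hypothesis u_neq0 : forall i, u i != 0.
Hypothesis Xu : forall i, X *m u i = u i.
Hypothesis isoP : forall i,
  dot (u i) ((\sum_(j | j != i) P j) *m u i) <= 0.

(** The terms of [isoP] are nonnegative with sum at most 0, so each vanishes and [u i] is isotropic
    for [P j]. At this stage [P j *m u i] is only tested against fixed vectors of [X]. *)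
Lemma resolution_weak_off i j k : j != i -> dot (u k) (P j *m u i) = 0.
Proof.
move=> ji; apply: psd_isotropic => // [s||].
- by apply: psdP; rewrite mulmxDr -scalemxAr !Xu.
- exact: psdP.
have := isoP i; rewrite mulmx_suml dot_sumr => sum_le0.
have P_ge0 k' : k' != i -> 0 <= dot (u i) (P k' *m u i) by move=> _; apply: psdP.
have : \sum_(k' | k' != i) dot (u i) (P k' *m u i) == 0.
  by rewrite eq_le sum_le0 sumr_ge0.
by rewrite psumr_eq0 // => /allP/(_ j (mem_index_enum j)); rewrite ji => /eqP.
Qed.

(** Expand c <u_k, u_i> as the sum of the <u_k, P_j u_i>. The terms j != i vanish as above, and the
    term j = i vanishes after moving [P i] to the other side. *)
Lemma resolution_orthogonal i k : k != i -> dot (u k) (u i) = 0.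
Proof.
move=> ki; apply: (mulfI c_neq0); rewrite mulr0 -dotZr -{1}(Xu i) scalemxAl.
rewrite -sumP mulmx_suml dot_sumr (bigD1 i) //= big1 => [|j]; last first.
  exact: resolution_weak_off.
by rewrite addr0 dot_mulmxr hP -dotC resolution_weak_off ?rmorph0 // eq_sym.
Qed.

(** The n vectors [u i] are nonzero and orthogonal, so their Gram matrix is invertible and they form
    a basis. The number of rows [m] is free because the result is also applied to a row vector. *)
Lemma resolution_complete m (M : 'M[C]_(m, n)) :
  (forall i, M *m u i = 0) -> M = 0.
Proof.
move=> Mu; pose U : 'M[C]_n := \matrix_(a, i) u i a 0.
have UU : U^t* *m U = diag_mx (\row_i dot (u i) (u i)).
  apply/matrixP => i j; rewrite !mxE.
  have -> : \sum_k (U^t*) i k * U k j = dot (u i) (u j).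
    by rewrite /dot; apply: eq_bigr => k _; rewrite !mxE.
  by case: eqVneq => [->|ij]; rewrite ?mulr1n // mulr0n resolution_orthogonal.
have : U^t* *m U \in unitmx.
  rewrite UU unitmxE det_diag unitfE; apply/prodf_neq0 => i _.
  by rewrite mxE dot_eq0.
rewrite unitmx_mul => /andP[_ unitU]; rewrite -(mulmxK unitU M).
suff -> : M *m U = 0 by rewrite mul0mx.
apply/matrixP => a i; have /matrixP/(_ a 0) := Mu i; rewrite !mxE => Mu0.
by rewrite -[RHS]Mu0; apply: eq_bigr => k _; congr (_ * _); rewrite mxE.
Qed.

Lemma resolution_base : X = 1%:M.
Proof.
apply/eqP; rewrite -subr_eq0; apply/eqP/resolution_complete => i.
by rewrite mulmxBl Xu mul1mx subrr.
Qed.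

(** The weak statement becomes an equality of vectors once the [u k] are known to span. *)
Lemma resolution_off i j : j != i -> P j *m u i = 0.
Proof.
move=> ji; apply/eqP; rewrite -dot_eq0; apply/eqP.
have /matrixP row0 : (P j *m u i)^t* = 0.
  apply: resolution_complete => k; apply/matrixP => a b; rewrite !mxE !ord1.
  have /(congr1 (@Num.conj C)) := resolution_weak_off i j k ji.
  rewrite rmorph0 dotC; apply: etrans.
  by apply: eq_bigr => l _; rewrite !mxE.
by apply: big1 => k _; have := row0 0 k; rewrite !mxE => ->; rewrite mul0r.
Qed.

Lemma resolution_diag i : P i *m u i = c *: u i.
Proof.
rewrite -[in RHS](Xu i) scalemxAl -sumP mulmx_suml (bigD1 i) //= big1 ?addr0 //.
by move=> j; apply: resolution_off.
Qed.

End Resolution.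

(** * Toeplitz sums, Herglotz symbols and Fourier vectors *)

Section ToeplitzSum.
Variables (C : numClosedFieldType) (n : nat).
Local Notation S := (jordanS C n).

(** Generic in [T], so that the same coefficients can be put on the S^k and on the phi(S^k). *)
Definition toeplitz_sum (T : nat -> 'M[C]_n) (c : nat -> C) : 'M[C]_n :=
  \sum_(k < n) c k *: T k.

(* The symbol 1 + 2 (sum_{k >= 1} (conj w z)^k), whose real part at S is the
   rank one matrix (w^(i - j)) when |w| = 1. *)
Definition herglotz (w : C) (k : nat) : C :=
  if k == 0%N then 1 else 2%:R * w^* ^+ k.

Definition fourier (w : C) : 'cV[C]_n := \col_i w ^+ i.

Lemma toeplitz_sum_sum (I : Type) (r : seq I) (Q : pred I) T (c : I -> nat -> C) :
  \sum_(j <- r | Q j) toeplitz_sum T (c j) =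
  toeplitz_sum T (fun k => \sum_(j <- r | Q j) c j k).
Proof.
by rewrite exchange_big; apply: eq_bigr => k _ /=; rewrite scaler_suml.
Qed.

Lemma mxpow_jordanE k (i j : 'I_n) : mxpow S k i j = ((i + k)%N == j)%:R.
Proof.
elim: k i => [|k IHk] i /=; first by rewrite mxE addn0.
rewrite mxE; have [lt_i|ge_i] := ltnP i.+1 n.
  rewrite (bigD1 (Ordinal lt_i)) //= big1 => [|l li].
    by rewrite IHk !mxE eqxx mul1r addr0 /= addSnnS.
  rewrite mxE; case: eqP => [il|_]; last by rewrite mul0r.
  by rewrite -val_eqE /= -il eqxx in li.
rewrite big1 => [|l _].
  by case: eqP => // ij; have := ltn_ord j; lia.
by rewrite mxE; case: eqP => [il|_]; [have := ltn_ord l; lia | rewrite mul0r].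
Qed.

Lemma toeplitz_jordanE c (i j : 'I_n) :
  toeplitz_sum (mxpow S) c i j = if (i <= j)%N then c (j - i)%N else 0.
Proof.
rewrite summxE; case: leqP => [le_ij|lt_ji].
  have lt_ji : (j - i < n)%N by rewrite (leq_ltn_trans (leq_subr _ _)).
  rewrite (bigD1 (Ordinal lt_ji)) //= big1 => [|k ki].
    by rewrite mxE mxpow_jordanE /= subnKC // eqxx mulr1 addr0.
  rewrite mxE mxpow_jordanE; case: eqP => [ikj|_]; last by rewrite mulr0.
  by move: ki; rewrite -val_eqE /= -ikj addKn eqxx.
rewrite big1 // => k _; rewrite mxE mxpow_jordanE.
by case: eqP => [|_]; [lia | rewrite mulr0].
Qed.

Lemma herglotz_real_part (w : C) : `|w| = 1 ->
  toeplitz_sum (mxpow S) (herglotz w) + (toeplitz_sum (mxpow S) (herglotz w))^t* =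
  2%:R *: (fourier w *m (fourier w)^t*).
Proof.
move=> w1; have ww : w * w^* = 1 by rewrite -normCK w1 expr1n.
apply/matrixP => i j; rewrite !mxE !toeplitz_jordanE big_ord1 !mxE.
have wwX k : w ^+ k * w^* ^+ k = 1 by rewrite -exprMn ww expr1n.
rewrite rmorphXn /= /herglotz; case: (ltngtP i j) => [lt_ij|lt_ji|ij].
- rewrite rmorph0 addr0 subn_eq0 leqNgt lt_ij /=; congr (_ * _).
  by rewrite -{2}(subnKC (ltnW lt_ij)) exprD mulrA wwX mul1r.
- rewrite add0r subn_eq0 leqNgt lt_ji /= rmorphM rmorph_nat rmorphXn /= conjCK.
  congr (_ * _).
  by rewrite -{2}(subnKC (ltnW lt_ji)) exprD mulrAC wwX mul1r.
- by rewrite ij subnn /= rmorph1 wwX mulr1.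
Qed.

Lemma dot_fourier_herglotz (w : C) u : `|w| = 1 ->
  dot u ((1%:M^t* *m toeplitz_sum (mxpow S) (herglotz w)
    + (toeplitz_sum (mxpow S) (herglotz w))^t* *m 1%:M) *m u) =
  2%:R * `|dot (fourier w) u| ^+ 2.
Proof.
move=> w1; rewrite trmx1 map_mx1 mul1mx mulmx1 herglotz_real_part //.
rewrite -scalemxAl dotZr -mulmxA normCK dotC; congr (_ * _).
have -> : (fourier w)^t* *m u = (dot (fourier w) u)%:M.
  apply/matrixP => i j; rewrite !mxE !ord1 /= mulr1n.
  by apply: eq_bigr => k _; rewrite !mxE.
by rewrite mul_mx_scalar dotZr.
Qed.

(** This provides the nonzero vector killed by the rank one real parts attached to all the other
    roots. *)
Lemma fourier_orthogonal (z b : C) (i j : 'I_n) : n.-primitive_root z ->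
  `|b| = 1 -> i != j -> dot (fourier (b * z ^+ j)) (fourier (b * z ^+ i)) = 0.
Proof.
move=> z_prim b1 ij; have n_gt0 := prim_order_gt0 z_prim.
have zn1 := prim_expr_order z_prim; have z1 := unity_norm _ _ _ n_gt0 zn1.
transitivity (\sum_(m < n) (z ^+ i * z^* ^+ j) ^+ m).
  apply: eq_bigr => m _; rewrite !mxE mulrC rmorphXn /= -exprMn.
  congr (_ ^+ _); rewrite rmorphM rmorphXn /=.
  by rewrite mulrACA -normCK b1 expr1n mul1r.
apply: sum_unity_root.
  by rewrite exprMn !(exprAC _ _ n) zn1 -rmorphXn zn1 rmorph1 !expr1n mulr1.
apply/eqP => zij; have /eqP : z ^+ i = z ^+ j.
  rewrite -[RHS]mul1r -zij -mulrA -exprMn [z^* * z]mulrC -normCK z1.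
  by rewrite expr1n expr1n mulr1.
rewrite (eq_prim_root_expr z_prim) !modn_small // => /eqP/val_inj/eqP.
by rewrite (negPf ij).
Qed.

Lemma fourier_neq0 (w : C) : (0 < n)%N -> fourier w != 0.
Proof.
move=> n_gt0; apply/eqP => /matrixP/(_ (Ordinal n_gt0) 0); rewrite !mxE /=.
by move=> /eqP; rewrite expr0 oner_eq0.
Qed.

Lemma sum_roots_herglotz (z b : C) k l : n.-primitive_root z -> `|b| = 1 ->
  (k < n)%N -> (l < n)%N ->
  \sum_(i < n) (b * z ^+ i) ^+ k * herglotz (b * z ^+ i) l =
  (k == l)%:R * (n%:R * (if l == 0%N then 1 else 2%:R)).
Proof.
move=> z_prim b1 lt_k lt_l.
rewrite mulrA -(sum_rotated_roots_conj C n z b k l) // big_distrl.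
apply: eq_bigr => i _; rewrite /herglotz; case: eqP => [->|_] //=.
  by rewrite expr0 !mulr1.
by rewrite mulrA mulrAC.
Qed.

(** Conjugating the symbol turns w^k into w^(k + l). For l > 0 the exponent lies strictly between 0
    and 2n, so only k + l = n survives; this aliasing produces the terms b^n X_(n-k)^*. *)
Lemma sum_roots_herglotz_conj (z b : C) k l : n.-primitive_root z -> `|b| = 1 ->
  (k < n)%N -> (l < n)%N ->
  \sum_(i < n) (b * z ^+ i) ^+ k * (herglotz (b * z ^+ i) l)^* =
  if l == 0%N then (k == 0%N)%:R * n%:R
  else (k + l == n)%N%:R * (2%:R * n%:R * b ^+ n).
Proof.
move=> z_prim b1 lt_k lt_l; rewrite /herglotz; case: eqP => [_|/eqP l0].
  under eq_bigr => i _ do rewrite rmorph1 mulr1.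
  rewrite (sum_rotated_roots C n z b k z_prim).
  have [->|k0] := eqVneq k 0%N; first by rewrite dvdn0 expr0 mulr1 mul1r.
  by rewrite gtnNdvd ?lt0n // mul0r.
under eq_bigr => i _.
  rewrite rmorphM rmorph_nat rmorphXn /= conjCK mulrCA -exprD; over.
rewrite -big_distrr /= (sum_rotated_roots C n z b (k + l) z_prim).
have -> : (n %| k + l)%N = (k + l == n)%N.
  apply/idP/eqP => [/dvdnP[[|[|m]]]|->] //; lia.
by case: eqP => [->|_]; rewrite ?mulr0 ?mul0r // mul1r mulrA.
Qed.

End ToeplitzSum.

(** * Images of the symbols under the isometry, and the power relation *)

Section LinearIsometry.
Variables (C : numClosedFieldType) (n : nat) (phi : 'M[C]_n -> 'M[C]_n).
Hypothesis n_gt0 : (0 < n)%N.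
Hypothesis hlin : linear_on_A phi.
Hypothesis hiso : isometry_on_A phi.
Local Notation S := (jordanS C n).
Let T k := phi (mxpow S k).

Lemma trmxC_sum (I : Type) (r : seq I) (Q : pred I) (F : I -> 'M[C]_n) :
  (\sum_(i <- r | Q i) F i)^t* = \sum_(i <- r | Q i) (F i)^t*.
Proof. by rewrite raddf_sum map_mx_sum. Qed.

Lemma trmxC_scale (a : C) (A : 'M[C]_n) : (a *: A)^t* = a^* *: A^t*.
Proof. by rewrite linearZ map_mxZ. Qed.

Lemma phi_sum m (c : nat -> C) :
  phi (\sum_(k < m) c k *: mxpow S k) = \sum_(k < m) c k *: T k.
Proof.
have in0 : inToeplitz (0 : 'M[C]_n).
  by exists 0%N, (fun=> 0); rewrite big_ord0.
have in_pow k : inToeplitz (mxpow S k).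
  exists k.+1, (fun i => (i == ord_max)%:R); rewrite big_ord_recr /= eqxx scale1r.
  rewrite big1 ?add0r // => i _; case: eqP => [/(congr1 val)/= ik|]; last by rewrite scale0r.
  by have := ltn_ord i; rewrite ik ltnn.
elim: m => [|m IHm]; rewrite ?big_ord0.
  (* Linearity at [1 *: 0 + 0] gives phi(0) = phi(0) + phi(0). *)
  by apply: (addIr (phi 0)); rewrite -{1}[phi 0]scale1r -hlin // scaler0 !add0r.
rewrite !big_ord_recr /= addrC hlin //; last by exists m, (fun i : 'I_m => c i).
by rewrite IHm addrC.
Qed.

Lemma iso_toeplitz (d : nat -> C) (t c : C) : 0 <= c ->
  opnorm_le (T 0 - t *: toeplitz_sum C n T d) c <->
  opnorm_le (1%:M - t *: toeplitz_sum C n (mxpow S) d) c.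
Proof.
move=> c_ge0.
pose e k := (k == 0%N)%:R - t * d k.
have split_sum (R : nat -> 'M[C]_n) :
    \sum_(k < n) e k *: R k = R 0%N - t *: toeplitz_sum C n R d.
  rewrite scaler_sumr -sumrN.
  under eq_bigr => k _ do rewrite scalerBl -scalerA.
  rewrite sumrB sumrN; congr (_ - _).
  rewrite (bigD1 (Ordinal n_gt0)) //= scale1r big1 ?addr0 // => k k0.
  by rewrite -val_eqE /= in k0; rewrite (negPf k0) scale0r.
rewrite -(split_sum T) -(split_sum (mxpow S)) -phi_sum.
by apply: hiso => //; exists n, (fun i : 'I_n => e i).
Qed.

Let hpart (A B : 'M[C]_n) := A^t* *m B + B^t* *m A.

(* Twice the P_i of the introduction, at [w = w_i]. *)
Let symbol_part w := hpart (T 0) (toeplitz_sum C n T (herglotz C w)).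

Lemma hpart_sum (A : 'M[C]_n) (I : Type) (r : seq I) (Q : pred I) F :
  hpart A (\sum_(i <- r | Q i) F i) = \sum_(i <- r | Q i) hpart A (F i).
Proof. by rewrite /hpart trmxC_sum mulmx_sumr mulmx_suml -big_split. Qed.

(** Discrete Fourier inversion over the roots: of the direct terms only l = k remains, of the
    adjoint terms only l = n - k, or l = 0 when k = 0. *)
Lemma weighted_symbol_part (z b : C) k : n.-primitive_root z -> `|b| = 1 ->
  (k < n)%N ->
  \sum_(i < n) (b * z ^+ i) ^+ k *: symbol_part (b * z ^+ i) =
  (2%:R * n%:R) *: (if k == 0%N then (T 0)^t* *m T 0
    else (T 0)^t* *m T k + b ^+ n *: ((T 0)^t* *m T (n - k))^t*).
Proof.
move=> z_prim b1 lt_k.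
transitivity (\sum_(l < n) (\sum_(i < n) (b * z ^+ i) ^+ k *
    herglotz C (b * z ^+ i) l) *: ((T 0)^t* *m T l)
  + \sum_(l < n) (\sum_(i < n) (b * z ^+ i) ^+ k *
    (herglotz C (b * z ^+ i) l)^*) *: ((T 0)^t* *m T l)^t*).
  rewrite -big_split /=; under [RHS]eq_bigr => l _ do
    rewrite !scaler_suml -big_split /=.
  rewrite exchange_big; apply: eq_bigr => i _ /=.
  rewrite /symbol_part /hpart /toeplitz_sum trmxC_sum mulmx_sumr mulmx_suml.
  rewrite -big_split scaler_sumr; apply: eq_bigr => l _ /=.
  rewrite -scalemxAr trmxC_scale -scalemxAl scalerDr !scalerA.
  by rewrite trmxC_mul trmxCK.
under eq_bigr => l _ do rewrite sum_roots_herglotz //.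
under [X in _ + X]eq_bigr => l _ do rewrite sum_roots_herglotz_conj //.
rewrite (bigD1 (Ordinal lt_k)) //= eqxx mul1r big1 => [|l]; last first.
  by rewrite -val_eqE /= eq_sym => /negPf ->; rewrite mul0r scale0r.
rewrite addr0; have [->|k0] := eqVneq k 0%N.
  rewrite (bigD1 (Ordinal n_gt0)) //= mul1r big1 => [|l]; last first.
    rewrite -val_eqE /= => /negPf l0; rewrite l0 add0n.
    by rewrite (ltn_eqF (ltn_ord l)) mul0r scale0r.
  by rewrite addr0 trmxC_mul trmxCK mulr1 -scalerDl; congr (_ *: _); ring.
have lt_nk : (n - k < n)%N by lia.
rewrite (bigD1 (Ordinal lt_nk)) //= big1 => [|l]; last first.
  rewrite -val_eqE /= => lk; case: eqP => _; first by rewrite mul0r scale0r.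
  by case: eqP => [|_]; [lia | rewrite mul0r scale0r].
have -> : (n - k == 0)%N = false by lia.
have -> : (k + (n - k) == n)%N by lia.
by rewrite mul1r addr0 scalerDr scalerA mulrC.
Qed.

Lemma isometry_resolution (z b : C) : n.-primitive_root z -> `|b| = 1 ->
  exists u : 'I_n -> 'cV[C]_n, [/\ (T 0)^t* *m T 0 = 1%:M,
    forall (M : 'M[C]_n), (forall i, M *m u i = 0) -> M = 0 &
    forall i j : 'I_n, symbol_part (b * z ^+ j) *m u i =
      ((i == j)%:R * (2%:R * n%:R)) *: u i].
Proof.
move=> z_prim b1; pose w (i : 'I_n) := b * z ^+ i.
have z1 := unity_norm C n z n_gt0 (prim_expr_order z_prim).
have w1 i : `|w i| = 1 by rewrite normrM normrX b1 z1 expr1n mulr1.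
(* The real part of [B i] is the sum of the rank one matrices of the other roots; it kills the
   Fourier vector of [w i], which is the input that yields [u i]. *)
pose B i := toeplitz_sum C n (mxpow S) (fun k => \sum_(j | j != i) herglotz C (w j) k).
have [i|u u_prop] := @fin_all_exists _ _ (fun i u => [/\ u != 0,
    (T 0)^t* *m T 0 *m u = u &
    dot u ((\sum_(j | j != i) symbol_part (w j)) *m u) <= 0]).
  have [||u [u0 Eu le0]] := first_order_le0 C n (T 0) _ (B i) (fun t c =>
      iso_toeplitz (fun k => \sum_(j | j != i) herglotz C (w j) k) t c)
      (fourier C n (w i)).
  - exact: fourier_neq0.
  - rewrite -/(hpart _ _) /B -toeplitz_sum_sum hpart_sum mulmx_suml dot_sumr.
    rewrite big1 // => j ji; rewrite dot_fourier_herglotz //.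
    by rewrite fourier_orthogonal 1?eq_sym // normr0 expr0n mulr0.
  exists u; split=> //; move: le0; rewrite -/(hpart _ _) -toeplitz_sum_sum.
  by rewrite hpart_sum.
have c_neq0 : 2%:R * n%:R != 0 :> C by rewrite -natrM pnatr_eq0 -lt0n muln_gt0.
have hP i : (symbol_part (w i))^t* = symbol_part (w i).
  exact: trmxC_hermitian_part.
have sumP : \sum_i symbol_part (w i) = (2%:R * n%:R) *: ((T 0)^t* *m T 0).
  rewrite -(weighted_symbol_part z b 0) //.
  by apply: eq_bigr => i _; rewrite expr0 scale1r.
have psdP i v : (T 0)^t* *m T 0 *m v = v -> 0 <= dot v (symbol_part (w i) *m v).
  apply: (first_order_ge0 C n (T 0) _ _ (iso_toeplitz (herglotz C (w i)))) => x.
  by rewrite dot_fourier_herglotz // mulr_ge0 // exprn_ge0.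
have u0 i : u i != 0 by have [] := u_prop i.
have Eu i : (T 0)^t* *m T 0 *m u i = u i by have [] := u_prop i.
have le0 i : dot (u i) ((\sum_(j | j != i) symbol_part (w j)) *m u i) <= 0.
  by have [] := u_prop i.
exists u; split.
- exact: (resolution_base C n _ _ _ u hP c_neq0 sumP psdP u0 Eu le0).
- exact: (resolution_complete C n _ _ _ u hP c_neq0 sumP psdP u0 Eu le0).
move=> i j; have [<-|ij] := eqVneq i j.
  by rewrite mul1r; apply: (resolution_diag C n _ _ _ u hP c_neq0 sumP psdP u0 Eu le0).
rewrite mul0r scale0r.
by apply: (resolution_off C n _ _ _ u hP c_neq0 sumP psdP u0 Eu le0); rewrite eq_sym.
Qed.

Lemma isometry_base_unitary : (T 0)^t* *m T 0 = 1%:M.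
Proof.
have [z z_prim] := primitive_root_exists C n n_gt0.
by have [u []] := isometry_resolution z 1 z_prim (normr1 _).
Qed.

(** For each m the matrix on the left with index m has the eigenvalue w_i^m at [u i], and the [u i]
    form a basis. *)
Lemma rotated_powers (b : C) k : `|b| = 1 -> (0 < k < n)%N ->
  (T 0)^t* *m T k + b ^+ n *: ((T 0)^t* *m T (n - k))^t* =
  mxpow ((T 0)^t* *m T 1 + b ^+ n *: ((T 0)^t* *m T (n - 1))^t*) k.
Proof.
move=> b1 /andP[k_gt0 lt_k].
have [z z_prim] := primitive_root_exists C n n_gt0.
have [u [_ complete Pu]] := isometry_resolution z b z_prim b1.
have c_neq0 : 2%:R * n%:R != 0 :> C by rewrite -natrM pnatr_eq0 -lt0n muln_gt0.
have eigen m i : (0 < m < n)%N ->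
    ((T 0)^t* *m T m + b ^+ n *: ((T 0)^t* *m T (n - m))^t*) *m u i =
    (b * z ^+ i) ^+ m *: u i.
  move=> /andP[m_gt0 lt_m]; apply: (scalerI c_neq0); rewrite scalemxAl.
  have := weighted_symbol_part z b m z_prim b1 lt_m.
  rewrite (gtn_eqF m_gt0) => <-; rewrite mulmx_suml (bigD1 i) //= big1 => [|j ji].
    by rewrite -scalemxAl Pu eqxx mul1r addr0 !scalerA mulrC.
  by rewrite -scalemxAl Pu eq_sym (negPf ji) mul0r scale0r scaler0.
have lt_1 : (0 < 1 < n)%N by rewrite (leq_ltn_trans k_gt0).
apply/eqP; rewrite -subr_eq0; apply/eqP/complete => i.
rewrite mulmxBl eigen ?k_gt0 //; apply/eqP; rewrite subr_eq0; apply/eqP/esym.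
elim: k {k_gt0 lt_k} => [|k IHk] /=; first by rewrite mul1mx expr0 scale1r.
by rewrite -mulmxA IHk -scalemxAr eigen // scalerA -exprSr.
Qed.

(** Both sides of the previous identity are polynomial in b and agree on the unit circle, so they
    agree at b = 0, where the adjoint terms disappear. *)
Lemma isometry_powers k : (0 < k < n)%N ->
  (T 0)^t* *m T k = mxpow ((T 0)^t* *m T 1) k.
Proof.
move=> k_bounds.
pose Y m : 'M[{poly C}]_n := map_mx polyC ((T 0)^t* *m T m)
  + 'X^n *: map_mx polyC (((T 0)^t* *m T (n - m))^t*).
have evalY m (b : C) : map_mx (horner_eval b) (Y m) =
    (T 0)^t* *m T m + b ^+ n *: ((T 0)^t* *m T (n - m))^t*.
  by apply/matrixP => i j; rewrite !mxE /horner_eval !hornerE.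
(* Powers over [{poly C}] are written with [iter], as [mxpow] is typed over a closed field. *)
have eval_pow (M : 'M[{poly C}]_n) m (b : C) :
    map_mx (horner_eval b) (iter m (mulmx M) 1%:M) =
    mxpow (map_mx (horner_eval b) M) m.
  elim: m => [|m IHm] /=; first by rewrite map_mx1.
  by rewrite map_mxM IHm.
have eqY : Y k = iter k (mulmx (Y 1%N)) 1%:M.
  apply/matrixP => i j; apply/eqP; rewrite -subr_eq0; apply/eqP.
  apply: poly_unimodular_eq0 => b b1; rewrite hornerD hornerN.
  have /matrixP/(_ i j) := rotated_powers b k b1 k_bounds.
  rewrite -!evalY -eval_pow !mxE /horner_eval => ->.
  by rewrite subrr.
have := congr1 (map_mx (horner_eval 0)) eqY.
by rewrite eval_pow !evalY expr0n (gtn_eqF n_gt0) !scale0r !addr0.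
Qed.

End LinearIsometry.

(** With phi(1) unitary, phi(S^k) = phi(1) X^k where X = phi(1)^* phi(S). Splitting off X on the
    right gives the kernels, and on the left, next to phi(1), the ranges. *)
Theorem theorem4p2 (C : numClosedFieldType) (n : nat) (phi : 'M[C]_n -> 'M[C]_n)
    (hlin : linear_on_A phi) (hiso : isometry_on_A phi) (k : nat)
    (hk1 : (1 <= k)%N) (hkn : (k <= n - 1)%N) :
  (forall x : 'cV[C]_n,
      phi (jordanS C n) *m x = 0 -> phi (mxpow (jordanS C n) k) *m x = 0) /\
  (forall y : 'cV[C]_n,
      (exists x : 'cV[C]_n, phi (mxpow (jordanS C n) k) *m x = y) ->
      exists x : 'cV[C]_n, phi (jordanS C n) *m x = y).
Proof.
have n_gt0 : (0 < n)%N by lia.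
have lt_k : (0 < k < n)%N by lia.
have unitT := isometry_base_unitary C n phi n_gt0 hlin hiso.
have Tk := isometry_powers C n phi n_gt0 hlin hiso k lt_k.
pose T0 := phi 1%:M; pose X := T0^t* *m phi (jordanS C n).
(* A one-sided inverse of a square matrix is two-sided. *)
have TT : T0 *m T0^t* = 1%:M by apply: mulmx1C.
have S1 : mxpow (jordanS C n) 1 = jordanS C n by rewrite /= mulmx1.
rewrite S1 in Tk.
have comm m : X *m mxpow X m = mxpow X m *m X.
  elim: m => [|m IHm] /=; first by rewrite mulmx1 mul1mx.
  by rewrite -[RHS]mulmxA -IHm.
(* One factor X can be isolated because k >= 1. *)
have {Tk} Tk : phi (mxpow (jordanS C n) k) = T0 *m (X *m mxpow X k.-1).
  rewrite -[LHS]mul1mx -TT -mulmxA Tk; congr (_ *m _).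
  by case: (k) hk1.
have T1 : phi (jordanS C n) = T0 *m X by rewrite mulmxA TT mul1mx.
have ker_X (x : 'cV[C]_n) : phi (jordanS C n) *m x = 0 -> X *m x = 0.
  by move=> T1x; rewrite /X -mulmxA T1x mulmx0.
clearbody X; split=> [x /ker_X Xx|y [x <-]].
  by rewrite Tk comm -!mulmxA Xx !mulmx0.
by exists (mxpow X k.-1 *m x); rewrite Tk T1 !mulmxA.
Qed.
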